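(* Let $G$ be a completely metrizable topological group with identity $e$, let $d$ be a left-invariant compatible metric on $G$, and let $T\colon G\to G$ be a continuous endomorphism of $G$. Then the following assertions are equivalent: (1) $T$ admits a semi-irregular point; (2) $T$ admits a Li-Yorke chaotic pair; (3) $T$ is Li-Yorke chaotic; (4) $T$ is Li-Yorke sensitive; (5) the restriction of $T$ to some $T$-invariant closed subgroup $\widetilde{G}$ of $G$ has a dense (in $\widetilde G$) set of semi-irregular points.
   Context: A topological group is completely metrizable if its topology is induced by some complete metric. A compatible metric $d$ on $G$ is a metric inducing the topology of $G$ (not required to be complete); it is left-invariant if $d(zx,zy)=d(x,y)$ for all $x,y,z\in G$. A continuous endomorphism is a continuous group homomorphism $G\to G$. A subset $Y\subset G$ is $T$-invariant if $TY\subset Y$. A point $x\in G$ is semi-irregular for $T$ if $\liminf_{n\to\infty} d(T^nx,e)=0$ and $\limsup_{n\to\infty} d(T^nx,e)>0$. A pair $(x,y)\in G\times G$ is Li-Yorke chaotic if $\liminf_{n\to\infty}d(T^nx,T^ny)=0$ and $\limsup_{n\to\infty}d(T^nx,T^ny)>0$. For $\delta>0$ it is Li-Yorke $\delta$-chaotic if $\liminf_{n\to\infty}d(T^nx,T^ny)=0$ and $\limsup_{n\to\infty}d(T^nx,T^ny)\ge\delta$. $T$ is Li-Yorke chaotic if there exists an uncountable set $K\subset G$ such that any two distinct points of $K$ form a Li-Yorke chaotic pair. $T$ is Li-Yorke sensitive if there exists $\delta>0$ such that for any $x\in G$ and $\varepsilon>0$ there exists $y\in G$ with $d(x,y)<\varepsilon$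 such that $(x,y)$ is Li-Yorke $\delta$-chaotic. *)

(* Defs.v *)
(* Library: MathComp and MathComp-Analysis. *)
From HB Require Import structures.
From mathcomp Require Import all_boot all_order all_algebra.
From mathcomp Require Import all_classical all_reals all_analysis.
Set Implicit Arguments.
Unset Strict Implicit.
Unset Printing Implicit Defensive.
Import Order.TTheory GRing.Theory Num.Theory.
Import numFieldNormedType.Exports.
Local Open Scope classical_set_scope.
Local Open Scope ring_scope.

(* Groups are multiplicative and not assumed commutative; no separation axiom
   is required here. *)
HB.structure Definition PreTopologicalGroup := {G of Topological G & Group G}.

HB.mixin Record PreTopologicalGroup_isTopologicalGroup G
    of PreTopologicalGroup G := {
  mulg_continuous : continuous (fun x : G * G => (x.1 * x.2)%g) ;
  invg_continuous : continuous (fun x : G => (x^-1)%g)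
}.

#[short(type="topologicalGroupType")]
HB.structure Definition TopologicalGroup :=
  {G of PreTopologicalGroup G & PreTopologicalGroup_isTopologicalGroup G}.

(* Metrics are kept as plain functions rather than as a [metricType]: several
   metrics (the given left-invariant one, and a complete one, which need not be
   left-invariant) live on the same topological group. *)
Record is_metric (R : realType) (X : Type) (d : X -> X -> R) : Prop := IsMetric {
  dist_xx : forall x, d x x = 0 ;
  dist_eq0 : forall x y, d x y = 0 -> x = y ;
  dist_sym : forall x y, d x y = d y x ;
  dist_triangle : forall x y z, d x z <= d x y + d y z
}.

Definition compatible_metric (R : realType) (X : topologicalType)
    (d : X -> X -> R) : Prop :=
  is_metric d /\
  forall (x : X) (A : set X),
    nbhs x A <-> exists2 e : R, 0 < e & [set y | d x y < e] `<=` A.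

Definition complete_metric (R : realType) (X : Type) (d : X -> X -> R) : Prop :=
  is_metric d /\
  forall u : nat -> X,
    (forall e : R, 0 < e ->
       exists N, forall m n, (N <= m)%N -> (N <= n)%N -> d (u m) (u n) < e) ->
    exists l : X, d (u n) l @[n --> \oo] --> (0 : R).

Definition completely_metrizable (R : realType) (X : topologicalType) : Prop :=
  exists rho : X -> X -> R, compatible_metric rho /\ complete_metric rho.

Definition left_invariant (R : realType) (G : groupType) (d : G -> G -> R) : Prop :=
  forall x y z : G, d (z * x)%g (z * y)%g = d x y.

(* Limits inferior and superior are taken in the extended reals, as the
   distances may be unbounded along an orbit. *)
Section Dynamics.
Context (R : realType) (X : Type) (d : X -> X -> R) (T : X -> X).

Definition orbit_dist (x y : X) : nat -> \bar R :=
  fun n => (d (iter n T x) (iter n T y))%:E.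

Definition semi_irregular (e x : X) : Prop :=
  limn_einf (fun n => (d (iter n T x) e)%:E) = 0%E /\
  (0 < limn_esup (fun n => (d (iter n T x) e)%:E))%E.

Definition LiYorke_pair (x y : X) : Prop :=
  limn_einf (orbit_dist x y) = 0%E /\ (0 < limn_esup (orbit_dist x y))%E.

Definition LiYorke_delta_pair (delta : R) (x y : X) : Prop :=
  limn_einf (orbit_dist x y) = 0%E /\
  (delta%:E <= limn_esup (orbit_dist x y))%E.

Definition LiYorke_chaotic : Prop :=
  exists K : set X, ~ countable K /\
    forall x y, K x -> K y -> x <> y -> LiYorke_pair x y.

Definition LiYorke_sensitive : Prop :=
  exists2 delta : R, 0 < delta &
    forall (x : X) (eps : R), 0 < eps ->
      exists y, d x y < eps /\ LiYorke_delta_pair delta x y.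

End Dynamics.

Record subgroup (G : groupType) (H : set G) : Prop := Subgroup {
  subgroup1 : H 1%g ;
  subgroupM : forall x y, H x -> H y -> H (x * y)%g ;
  subgroupV : forall x, H x -> H (x^-1)%g
}.

Definition subgroup_one (G : groupType) (H : set G) (sH : subgroup H) : H :=
  exist _ 1%g (mem_set (subgroup1 sH)).

Definition sub_dist (R : realType) (X : Type) (A : set X) (d : X -> X -> R) :
    A -> A -> R :=
  fun x y => d (\val x) (\val y).

(* [set_fun A A T] says that T maps A into A. *)
Definition restriction (X : Type) (A : set X) (T : X -> X)
    (TA : set_fun A A T) : A -> A :=
  sigLR (mkfun TA).

(* Density is relative to the subtype topology on H. *)
Definition has_dense_semi_irregular_restriction (R : realType)
    (G : topologicalGroupType) (d : G -> G -> R) (T : G -> G) : Prop :=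
  exists (H : set G) (sH : subgroup H) (TH : set_fun H H T),
    closed H /\
    dense [set x : H |
      semi_irregular (sub_dist d) (restriction TH) (subgroup_one sH) x].

(* Main.v *)
Require Import Defs.
From mathcomp Require Import all_boot all_order all_algebra.
From mathcomp Require Import all_classical all_reals all_analysis.
From mathcomp Require Import lra.
(** Left invariance and the fact that [T] is a homomorphism give
    [d (T^n x) (T^n y) = d 1 (T^n (x^-1 y))], so a pair is Li-Yorke chaotic
    exactly when [x^-1 y] is semi-irregular: pairs and points carry the same
    information, and every property of pairs can be translated by an element
    of [G] ([scrambled_translate]).

    Let [x] be semi-irregular, with [d 1 (T^n x) > c > 0] for infinitely many
    [n]. The iterates [T^m x] are as scrambled against [1] as [x] is, and those
    along a suitable sequence [phi] tend to [1]. So near every [y] there is a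
    point [y * T^(phi k) x] which forms with [y] a pair that separates by more
    than [c] infinitely often: this is sensitivity ([scrambled_sensitive]).

    For the other two properties, let [H] be the set of all [z] with
    [T^(phi k) z] tending to [1]. It is a [T]-invariant subgroup which contains
    [x], and all its elements return to [1] along the one sequence [phi]; its
    closure is an invariant closed subgroup. Take [h] in [H]. Either the orbit
    of [h] is at distance more than [c / 2] from [1] infinitely often, or it
    stays within [c / 2] from some time on, and then the orbit of
    [h * T^(phi k) x], a point of [H] close to [h], leaves the ball of radius
    [c / 2] infinitely often. Hence the semi-irregular points of [H] are dense
    in the closure of [H] ([dense_scrambled]), with a uniform constant [c / 2].

    By the same density, for each [g] in the closure of [H] the points [y]
    there for which [(g, y)] is scrambled form a dense G-delta. By Baire's
    theorem a countable scrambled set can be enlarged, so a maximal one, given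
    by Zorn's lemma, is uncountable ([scrambled_chaotic]). Only this last step
    uses completeness, and it uses it through a complete metric that need not
    be the left-invariant one. *)

Set Implicit Arguments.
Unset Strict Implicit.
Unset Printing Implicit Defensive.
Import Order.TTheory GRing.Theory Num.Theory.
Import numFieldNormedType.Exports.
Local Open Scope classical_set_scope.
Local Open Scope ring_scope.

(** * Limits inferior and superior as recurrence *)

Definition frequently (P : nat -> Prop) : Prop :=
  forall N, exists2 n, (N <= n)%N & P n.

Lemma not_frequently (P : nat -> Prop) :
  ~ frequently P -> exists N, forall n, (N <= n)%N -> ~ P n.
Proof.
move=> /existsNP[N nP]; exists N => n Nn Pn; apply: nP.
by exists n.
Qed.

Section LimSupInf.
Context (R : realType).
Implicit Types (u : nat -> \bar R) (v : nat -> R).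
Local Open Scope ereal_scope.

Lemma frequently_le_limn_esup u c :
  frequently (fun n => c <= u n) -> c <= limn_esup u.
Proof.
move=> uc; apply: le_ereal_inf_tmp => _ [V [N _ NV] <-].
have [n Nn cn] := uc N; apply: (le_trans cn); apply: ereal_sup_ubound.
by exists n => //; apply: NV.
Qed.

Lemma limn_esup_le u c N :
  (forall n, (N <= n)%N -> u n <= c) -> limn_esup u <= c.
Proof.
move=> uc; apply: ereal_inf_le.
exists (ereal_sup [set u n | n in [set n | (N <= n)%N]]).
  by exists [set n | (N <= n)%N] => //; exists N.
by apply: ge_ereal_sup => _ [n /= Nn <-]; apply: uc.
Qed.

Lemma limn_einf_eq0 v : (forall n, (0 <= v n)%R) ->
  limn_einf (fun n => (v n)%:E) = 0 <->
  (forall e : R, (0 < e)%R -> frequently (fun n => (v n < e)%R)).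
Proof.
move=> v0; rewrite /limn_einf; split => [v_0 e e0|v_small].
  apply: contrapT => /not_frequently[N Nv].
  have : limn_esup (\- (fun n => (v n)%:E)) <= (- e)%:E.
    apply: (@limn_esup_le _ _ N) => n /Nv /negP.
    by rewrite -leNgt /= lee_fin lerN2.
  move/eqP: v_0; rewrite oppe_eq0 => /eqP ->.
  by rewrite lee_fin oppr_ge0 leNgt e0.
suff -> : limn_esup (\- (fun n => (v n)%:E)) = 0 by rewrite oppe0.
apply/eqP; rewrite eq_le; apply/andP; split.
  by apply: (@limn_esup_le _ _ 0%N) => n _; rewrite lee_fin oppr_le0.
apply/lee_addgt0Pr => e e0; rewrite -leeBlDr// sub0e.
apply: frequently_le_limn_esup => N; have [n Nn vn] := v_small e e0 N.
by exists n => //=; rewrite lee_fin lerN2 ltW.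
Qed.

Lemma limn_esup_gt0 v :
  0 < limn_esup (fun n => (v n)%:E) <->
  exists2 c : R, (0 < c)%R & frequently (fun n => (c < v n)%R).
Proof.
split=> [v0|[c c0 cv]]; last first.
  apply: (@lt_le_trans _ _ c%:E); first by rewrite lte_fin.
  apply: frequently_le_limn_esup => N; have [n Nn cn] := cv N.
  by exists n => //; rewrite lee_fin ltW.
apply: contrapT => noc; move: v0; apply/negP; rewrite -leNgt.
apply/lee_addgt0Pr => c c0; rewrite add0e.
have /not_frequently[N Nv] : ~ frequently (fun n => (c < v n)%R).
  by move=> cv; apply: noc; exists c.
by apply: (@limn_esup_le _ _ N) => n /Nv/negP; rewrite -leNgt lee_fin.
Qed.

End LimSupInf.

(** * Topology from a compatible metric *)

Section Metric.
Context (R : realType) (X : topologicalType) (d : X -> X -> R).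
Hypothesis d_compat : compatible_metric d.

Let d_metric : is_metric d := d_compat.1.

Lemma dist_ge0 x y : 0 <= d x y.
Proof.
have := dist_triangle d_metric x y x.
rewrite (dist_xx d_metric) (dist_sym d_metric y x); lra.
Qed.

Lemma nbhs_dist_lt x (e : R) : 0 < e -> nbhs x [set y | d x y < e].
Proof. by move=> e0; apply/(d_compat.2 x); exists e. Qed.

Lemma open_dist_lt a (r : R) : open [set y | d a y < r].
Proof.
rewrite openE => y /= ay; apply/(d_compat.2 y).
exists (r - d a y); first by rewrite subr_gt0.
by move=> z /= yz; have := dist_triangle d_metric a y z; lra.
Qed.

Lemma open_dist_gt a (r : R) : open [set y | r < d a y].
Proof.
rewrite openE => y /= ay; apply/(d_compat.2 y).
exists (d a y - r); first by rewrite subr_gt0.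
move=> z /= yz; have := dist_triangle d_metric a z y.
by rewrite (dist_sym d_metric z y); lra.
Qed.

End Metric.

(** * Baire's theorem on a closed set *)

Section Baire.
Context (R : realType) (X : topologicalType) (rho : X -> X -> R).
Hypothesis rho_compat : compatible_metric rho.
Hypothesis rho_complete : complete_metric rho.

Let rho_metric : is_metric rho := rho_compat.1.

(** Nested closed balls, for a metric given as a plain function. Working inside
    a closed set [C] with density expressed relative to [C] avoids putting a
    topology and a metric on the subtype. *)
Lemma Baire_closed_nat (C : set X) (U : nat -> set X) :
  closed C -> C !=set0 -> (forall n, open (U n)) ->
  (forall n a W, C a -> open W -> W a -> exists z, [/\ C z, W z & U n z]) ->
  exists2 l, C l & forall n, U n l.
Proof.
move=> Ccl [c0 Cc0] Uo Ud.
(* A state [(n, c, r)] is the [n]-th closed ball, of center [c] and radius [r];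
   carrying [n] in the state tells the step which [U n] to enter. *)
pose good (p : nat * X * R) := C p.1.2 /\ 0 < p.2.
pose step (p q : nat * X * R) := good p ->
  [/\ q.1.1 = p.1.1.+1, good q, q.2 <= p.2 / 2 &
   forall y, rho q.1.2 y <= q.2 -> rho p.1.2 y <= p.2 /\ U p.1.1 y].
have next p : {q | step p q}.
  apply: cid; case: p => [[n c] r]; rewrite /step /good /=.
  have [[Cc r0]|no_good] := pselect (C c /\ 0 < r); last by exists (n, c, r).
  have [z [Cz /= cz Uz]] : exists z, [/\ C z, [set y | rho c y < r] z & U n z].
    apply: Ud Cc _ _; first exact: open_dist_lt.
    by rewrite /= (dist_xx rho_metric).
  have /(rho_compat.2 z)[e e0 ez] : nbhs z (U n).
    by apply: open_nbhs_nbhs; split.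
  (* The halves leave room for a closed ball inside the open ones, and make
     the radii tend to 0. *)
  pose s := Num.min (r / 2) (Num.min (e / 2) ((r - rho c z) / 2)).
  have sr : s <= r / 2 by rewrite /s ge_min lexx.
  have se : s <= e / 2 by rewrite /s !ge_min lexx orbT.
  have sz : s <= (r - rho c z) / 2 by rewrite /s !ge_min lexx !orbT.
  have s0 : 0 < s.
    rewrite /s !lt_min !divr_gt0 //= ?subr_gt0 //.
  exists (n.+1, z, s) => _; split => //= y zy; split.
    by have := dist_triangle rho_metric c z y; lra.
  by apply: ez => /=; lra.
have [f [f0 fS]] := dependent_choice next (0%N, c0, 1).
have fgood n : good (f n).
  elim: n => [|n IH]; first by rewrite f0; split.
  by have [] := fS n IH.
have fn n : (f n).1.1 = n.
  elim: n => [|n IH]; first by rewrite f0.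
  by have [-> _ _ _] := fS n (fgood n); rewrite IH.
pose c n := (f n).1.2; pose r n := (f n).2.
have r_small e : 0 < e -> exists N, r N < e.
  move=> e0.
  have r_le n : r n <= 2^-1 ^+ n.
    elim: n => [|n IH]; first by rewrite /r f0 expr0.
    have [_ _ + _] := fS n (fgood n); rewrite -/(r n) -/(r n.+1) exprSr.
    move=> rS; apply: (le_trans rS); rewrite ler_wpM2r // invr_ge0.
  have : (2^-1 : R) ^+ n @[n --> \oo] --> 0.
    by apply: cvg_expr; rewrite ger0_norm ?invr_ge0// invf_lt1// ltr1n.
  move=> /cvgrPdist_lt/(_ e e0)[N _ /(_ N (leqnn N))].
  rewrite /= sub0r normrN ger0_norm ?exprn_ge0 ?invr_ge0//.
  by exists N; apply: le_lt_trans (r_le N) _.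
have nested m n y : (m <= n)%N -> rho (c n) y <= r n -> rho (c m) y <= r m.
  move=> /subnK <-; elim: (n - m)%N => // k IH.
  rewrite addSn => H; apply: IH.
  have [_ _ _ S] := fS (k + m)%N (fgood _).
  by have [] := S y H.
have cc m n : (m <= n)%N -> rho (c m) (c n) <= r m.
  move=> mn; apply: (nested m n) => //.
  by rewrite (dist_xx rho_metric) ltW //; have [] := fgood n.
have [l cl] : exists l, rho (c n) l @[n --> \oo] --> (0 : R).
  apply: rho_complete.2 => e e0.
  have [|N rN] := r_small (e / 2); first lra.
  exists N => m n Nm Nn; have := dist_triangle rho_metric (c m) (c N) (c n).
  have := cc _ _ Nm; have := cc _ _ Nn.
  by rewrite (dist_sym rho_metric (c m) (c N)); lra.
have l_ev e : 0 < e -> exists N, forall n, (N <= n)%N -> rho (c n) l < e.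
  move=> e0; have /cvgrPdist_lt/(_ e e0)[N _ Nl] := cl.
  exists N => n Nn; have := Nl n Nn; rewrite /= sub0r normrN ger0_norm //.
  exact: dist_ge0 rho_compat _ _.
have l_in m : rho (c m) l <= r m.
  apply/ler_addgt0Pr => e e0; have [N Nl] := l_ev e e0.
  have := dist_triangle rho_metric (c m) (c (maxn m N)) l.
  have := cc _ _ (leq_maxl m N); have := Nl _ (leq_maxr m N); lra.
exists l.
  apply: Ccl => B /(rho_compat.2 l)[e e0 eB].
  have [N Nl] := l_ev e e0; exists (c N); split; first by have [] := fgood N.
  by apply: eB => /=; rewrite (dist_sym rho_metric); apply: Nl.
move=> n; have [_ _ _ S] := fS n (fgood n).
by have [_] := S l (l_in n.+1); rewrite fn.
Qed.

(** Allows double sequences of open sets, as for a countable family of dense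
    G-delta sets. *)
Lemma Baire_closed (I : countType) (C : set X) (U : I -> set X) :
  closed C -> C !=set0 -> (forall i, open (U i)) ->
  (forall i a W, C a -> open W -> W a -> exists z, [/\ C z, W z & U i z]) ->
  exists2 l, C l & forall i, U i l.
Proof.
move=> Ccl C0 Uo Ud.
pose V n := if unpickle n is Some i then U i else setT.
have [||l Cl Vl] := @Baire_closed_nat C V Ccl C0.
- by move=> n; rewrite /V; case: unpickle => [i|]; [exact: Uo|exact: openT].
- move=> n a W Ca Wo Wa; rewrite /V; case: unpickle => [i|]; last by exists a.
  exact: Ud Ca Wo Wa.
by exists l => // i; have := Vl (pickle i); rewrite /V pickleK.
Qed.

End Baire.

(** * Scrambled pairs *)

Section ScrambledPairs.
Context (R : realType) (X : topologicalType) (d : X -> X -> R) (T : X -> X).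
Hypothesis d_compat : compatible_metric d.

(** A Li-Yorke chaotic pair with an explicit constant. The inequalities are strict
    so that, with one point fixed, each of the conditions on the other one
    is a countable intersection of open sets. *)
Definition scrambled (c : R) (x y : X) : Prop :=
  (forall e, 0 < e -> frequently (fun n => d (iter n T x) (iter n T y) < e)) /\
  frequently (fun n => c < d (iter n T x) (iter n T y)).

Lemma LiYorke_pairP x y :
  LiYorke_pair d T x y <-> exists2 c, 0 < c & scrambled c x y.
Proof.
have d0 n : 0 <= d (iter n T x) (iter n T y) by apply: dist_ge0.
split=> [[/(limn_einf_eq0 d0) prox /limn_esup_gt0[c c0 sep]]|[c c0 [prox sep]]].
  by exists c.
by split; [apply/(limn_einf_eq0 d0)|apply/limn_esup_gt0; exists c].
Qed.

Lemma scrambled_delta_pair c x y : scrambled c x y -> LiYorke_delta_pair d T c x y.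
Proof.
have d0 n : 0 <= d (iter n T x) (iter n T y) by apply: dist_ge0.
move=> [prox sep]; split; first exact/(limn_einf_eq0 d0).
apply: frequently_le_limn_esup => N; have [n Nn cn] := sep N.
by exists n => //; rewrite lee_fin ltW.
Qed.

Lemma delta_pair_LiYorke_pair c x y : 0 < c ->
  LiYorke_delta_pair d T c x y -> LiYorke_pair d T x y.
Proof.
by move=> c0 [prox sep]; split=> //; apply: lt_le_trans sep; rewrite lte_fin.
Qed.

Lemma scrambled_sym c x y : scrambled c x y -> scrambled c y x.
Proof.
move=> [prox sep]; split=> [e /prox small N|N].
  by have [n Nn dn] := small N; exists n; rewrite // (dist_sym d_compat.1).
by have [n Nn dn] := sep N; exists n; rewrite // (dist_sym d_compat.1).
Qed.

Lemma not_scrambled_refl c x : 0 < c -> ~ scrambled c x x.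
Proof.
move=> c0 [_ /(_ 0%N)[n _]]; rewrite (dist_xx d_compat.1).
by move=> /(lt_trans c0); rewrite ltxx.
Qed.

End ScrambledPairs.

(** * Topological groups *)

Section TopologicalGroupFacts.
Context (G : topologicalGroupType).

Lemma cvgMg (I : Type) (F : set_system I) (FF : Filter F) (f g : I -> G) (a b : G) :
  f @ F --> a -> g @ F --> b -> (fun i => f i * g i)%g @ F --> (a * b)%g.
Proof.
move=> fa gb.
apply: (@cvg_comp _ _ _ (fun i => (f i, g i)) (fun p : G * G => (p.1 * p.2)%g)).
  exact: cvg_pair fa gb.
exact: (@mulg_continuous G (a, b)).
Qed.

Lemma cvgVg (I : Type) (F : set_system I) (FF : Filter F) (f : I -> G) (a : G) :
  f @ F --> a -> (fun i => (f i)^-1)%g @ F --> (a^-1)%g.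
Proof. by move=> fa; apply: cvg_comp fa (@invg_continuous G a). Qed.

Lemma mulg_left_continuous (g : G) : continuous (fun z : G => g * z)%g.
Proof. by move=> z; apply: cvgMg; [exact: cvg_cst|exact: cvg_id]. Qed.

Lemma subgroup_closure (H : set G) : subgroup H -> subgroup (closure H).
Proof.
move=> sH; split; first exact: subset_closure (subgroup1 sH).
- move=> x y Hx Hy B.
  move=> /(@mulg_continuous G (x, y))[[U V] /= [xU yV] UVB].
  have [u [Hu Uu]] := Hx U xU; have [v [Hv Vv]] := Hy V yV.
  exists (u * v)%g; split; first exact: subgroupM.
  exact: (UVB (u, v)).
- move=> x Hx B /(@invg_continuous G x) /Hx[u [Hu Bu]].
  by exists (u^-1)%g; split=> //; exact: subgroupV.
Qed.

End TopologicalGroupFacts.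

Lemma image_closure (X Y : topologicalType) (f : X -> Y) (A : set X) (B : set Y) :
  continuous f -> set_fun A B f -> set_fun (closure A) (closure B) f.
Proof.
move=> fc fAB x Ax V /fc /Ax[a [Aa Va]].
by exists (f a); split=> //; exact: fAB.
Qed.

(** * Orbits under an endomorphism *)

Section Endomorphism.
Context (R : realType) (G : topologicalGroupType) (d : G -> G -> R).
Hypothesis (d_compat : compatible_metric d) (d_left : left_invariant d).
Context (T : UMagmaMorphism.type G G).
Hypothesis T_cont : continuous T.

Let d_metric : is_metric d := d_compat.1.

Lemma iter_endo1 n : iter n T 1%g = 1%g.
Proof. by elim: n => //= n ->; rewrite gmulf1. Qed.

Lemma iter_endoM n x y : iter n T (x * y)%g = (iter n T x * iter n T y)%g.
Proof. by elim: n => //= n ->; rewrite gmulfM. Qed.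

Lemma iter_endoV n x : iter n T (x^-1)%g = ((iter n T x)^-1)%g.
Proof. by elim: n => //= n ->; rewrite gmulfV. Qed.

Lemma continuous_iter n : continuous (iter n T).
Proof.
elim: n => [|n IH] x; first exact: cvg_id.
exact: cvg_comp (IH x) (T_cont (x := _)).
Qed.

Lemma orbit_dist_translate g x y n :
  d (iter n T (g * x)%g) (iter n T (g * y)%g) = d (iter n T x) (iter n T y).
Proof. by rewrite !iter_endoM d_left. Qed.

Lemma scrambled_translate c g x y :
  scrambled d T c (g * x)%g (g * y)%g <-> scrambled d T c x y.
Proof.
split=> -[prox sep].
  split=> [e /prox small N|N].
    by have [n Nn] := small N; rewrite orbit_dist_translate; exists n.
  by have [n Nn] := sep N; rewrite orbit_dist_translate; exists n.
split=> [e /prox small N|N].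
  by have [n Nn] := small N; exists n; rewrite // orbit_dist_translate.
by have [n Nn] := sep N; exists n; rewrite // orbit_dist_translate.
Qed.

Lemma semi_irregularP x :
  semi_irregular d T 1%g x <-> exists2 c, 0 < c & scrambled d T c 1%g x.
Proof.
have -> : semi_irregular d T 1%g x = LiYorke_pair d T x 1%g.
  rewrite /semi_irregular /LiYorke_pair /orbit_dist.
  by under [in RHS]eq_fun do rewrite iter_endo1.
rewrite LiYorke_pairP //; split=> -[c c0 xc]; exists c => //;
  exact: scrambled_sym.
Qed.

Lemma semi_irregular_restriction (H : set G) (sH : subgroup H)
    (TH : set_fun H H T) (z : H) :
  semi_irregular (sub_dist d) (restriction TH) (subgroup_one sH) z =
  semi_irregular d T 1%g (\val z).
Proof.
have iterE n : \val (iter n (restriction TH) z) = iter n T (\val z).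
  by elim: n => //= n <-.
rewrite /semi_irregular; set u := (fun n => (sub_dist _ _ _)%:E).
suff -> : u = fun n => (d (iter n T (\val z)) 1%g)%:E by [].
by apply/funext => n; rewrite /u /sub_dist iterE.
Qed.

(** * The subgroup of points null along a sequence *)

(** Fixing the sequence of times is what makes this a subgroup: a product of two
    points that return to [1] along different sequences need not return. *)
Definition null_along (phi : nat -> nat) : set G :=
  [set z | iter (phi k) T z @[k --> \oo] --> (1%g : G)].

Lemma null_along_subgroup phi : subgroup (null_along phi).
Proof.
split; rewrite /null_along /=.
- under eq_fun do rewrite iter_endo1; exact: cvg_cst.
- move=> x y xphi yphi; under eq_fun do rewrite iter_endoM.
  by rewrite -(mulg1 1%g); apply: cvgMg.
- move=> x xphi; under eq_fun do rewrite iter_endoV.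
  by rewrite -invg1; apply: cvgVg.
Qed.

Lemma null_along_invariant phi : set_fun (null_along phi) (null_along phi) T.
Proof.
move=> x xphi; rewrite /null_along /=.
under eq_fun do rewrite -iterSr iterS.
by rewrite -(gmulf1 (s := T)); apply: cvg_comp xphi (T_cont (x := _)).
Qed.

Lemma null_along_iter phi n x : null_along phi x -> null_along phi (iter n T x).
Proof. by move=> Hx; elim: n => //= n; exact: null_along_invariant. Qed.

Lemma null_along_proximal phi z : (forall k, (k <= phi k)%N) ->
  null_along phi z -> forall e, 0 < e ->
  frequently (fun n => d (iter n T 1%g) (iter n T z) < e).
Proof.
move=> phi_ge zphi e e0 N.
have [K _ Ke] := zphi _ (nbhs_dist_lt d_compat 1%g e0).
exists (phi (maxn K N)); first exact: leq_trans (leq_maxr _ _) (phi_ge _).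
by rewrite iter_endo1; apply: Ke; exact: leq_maxl.
Qed.

Lemma exists_null_along c x : scrambled d T c 1%g x ->
  exists2 phi : nat -> nat, (forall k, (k <= phi k)%N) & null_along phi x.
Proof.
move=> [prox _].
have /choice[phi phiP] k : exists n,
    (k <= n)%N /\ d (iter n T 1%g) (iter n T x) < k.+1%:R^-1.
  have [|n kn dn] := prox k.+1%:R^-1 _ k; first by rewrite invr_gt0.
  by exists n.
exists phi => [k|A /(d_compat.2 _)[e e0 eA]]; first by have [] := phiP k.
have [N _ Ne] := near_infty_natSinv_lt (PosNum e0).
exists N => // k /Ne /= ke; apply: eA => /=.
by have [_] := phiP k; rewrite iter_endo1 => /lt_trans; apply.
Qed.

(** * Consequences of one recurrent, repeatedly escaping point *)

Section Recurrence.
Context (phi : nat -> nat) (c : R) (x : G).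
Hypothesis phi_ge : forall k, (k <= phi k)%N.
Hypothesis x_null : null_along phi x.
Hypothesis c_gt0 : 0 < c.
Hypothesis x_far : frequently (fun n => c < d (iter n T 1%g) (iter n T x)).

Lemma iter_far m : frequently (fun n =>
  c < d (iter n T 1%g) (iter n T (iter m T x))).
Proof.
move=> N; have [n Nn xn] := x_far (N + m)%N.
exists (n - m)%N; first by rewrite leq_subRL ?(leq_trans _ Nn)// ?leq_addl// addnC.
rewrite -iterD subnK ?(leq_trans _ Nn)// ?leq_addl//.
by move: xn; rewrite !iter_endo1.
Qed.

(** Multiplying a point [h] by a small iterate of [x] perturbs it little. If the
    orbit of [h] stays within [c / 2] of the identity, left invariance forces the
    perturbed orbit beyond [c - c / 2] whenever that of [x] is beyond [c]. *)
Lemma dense_scrambled (a : G) (W : set G) :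
  closure (null_along phi) a -> open W -> W a ->
  exists z, [/\ null_along phi z, W z & scrambled d T (c / 2) 1%g z].
Proof.
move=> Ha Wo Wa.
suff [z [Hz Wz zfar]] : exists z, [/\ null_along phi z, W z &
    frequently (fun n => c / 2 < d (iter n T 1%g) (iter n T z))].
  by exists z; split=> //; split=> //; exact: null_along_proximal.
have [h [Hh Wh]] : (null_along phi `&` W) !=set0.
  by apply: Ha; apply: open_nbhs_nbhs.
have [h_far|/not_frequently[N h_near]] :=
  pselect (frequently (fun n => c / 2 < d (iter n T 1%g) (iter n T h))).
  by exists h.
have : (h * iter (phi k) T x)%g @[k --> \oo] --> h.
  by rewrite -[X in _ --> X]mulg1; apply: cvgMg => //; exact: cvg_cst.
have hW : nbhs h W by apply: open_nbhs_nbhs.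
move=> /(_ _ hW)[K _ /(_ K (leqnn K)) /= WK].
exists (h * iter (phi K) T x)%g; split=> //.
  by apply: (subgroupM (null_along_subgroup phi)) => //; exact: null_along_iter.
move=> M; have [n Mn xn] := iter_far (phi K) (maxn M N).
exists n; first exact: leq_trans (leq_maxl _ _) Mn.
have /h_near/negP : (N <= n)%N by exact: leq_trans (leq_maxr _ _) Mn.
rewrite -leNgt; move: xn; rewrite iter_endoM !iter_endo1.
set u := iter n T h; set v := iter n T (iter _ T x) => cv hu.
have := dist_triangle d_metric u 1%g (u * v)%g.
rewrite (dist_sym d_metric u 1%g) -{1}[u]mulg1 d_left; lra.
Qed.

Lemma scrambled_sensitive : LiYorke_sensitive d T.
Proof.
exists c => // y e e0.
have [K _ /(_ K (leqnn K)) /= Ke] := x_null (nbhs_dist_lt d_compat 1%g e0).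
exists (y * iter (phi K) T x)%g; split.
  by rewrite -{1}[y]mulg1 d_left.
apply: scrambled_delta_pair => //; rewrite -{1}[y]mulg1.
apply/scrambled_translate; split; last exact: iter_far.
apply: null_along_proximal => //; exact: null_along_iter.
Qed.

Lemma scrambled_dense_restriction : has_dense_semi_irregular_restriction d T.
Proof.
pose H := closure (null_along phi).
have sH : subgroup H := subgroup_closure (null_along_subgroup phi).
have TH : set_fun H H T := image_closure T_cont (null_along_invariant (phi := phi)).
exists H, sH, TH; split; first exact: closed_closure.
move=> O [[a Ha] Oa] [W Wo WO]; have Wa : W a by rewrite -WO in Oa.
have [z [Hz Wz zc]] := dense_scrambled (set_mem Ha) Wo Wa.
exists (exist _ z (mem_set (subset_closure Hz))); split; first by rewrite -WO.
rewrite /= semi_irregular_restriction; apply/semi_irregularP.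
by exists (c / 2) => //; rewrite divr_gt0.
Qed.

(** Maximality replaces the construction of a Cantor set: a point produced by
    Baire's theorem that is scrambled against every member of a countable [K]
    lies outside [K], since no point is scrambled against itself. *)
Lemma scrambled_chaotic : completely_metrizable R G -> LiYorke_chaotic d T.
Proof.
move=> [rho [rho_compat rho_complete]].
pose C := closure (null_along phi).
have sC : subgroup C := subgroup_closure (null_along_subgroup phi).
pose chaotic_set (K : set G) := K `<=` C /\
  forall y z, K y -> K z -> y <> z -> scrambled d T (c / 2) y z.
have [K [[KC Kscr] Kmax]] : exists K, chaotic_set K /\
    forall B, K `<` B -> ~ chaotic_set B.
  apply: Zorn_bigcup => F Fchaotic Ftotal; split.
    by move=> y [B FB By]; exact: (Fchaotic B FB).1.
  move=> y z [B FB By] [B' FB' B'z].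
  have [BB'|B'B] := Ftotal _ _ FB FB'.
    by apply: (Fchaotic B' FB').2 => //; exact: BB'.
  by apply: (Fchaotic B FB).2 => //; exact: B'B.
exists K; split=> [/countable_injP[code code_inj]|y z Ky Kz yz]; last first.
  by apply/LiYorke_pairP => //; exists (c / 2); [rewrite divr_gt0|exact: Kscr].
(* [g] enumerates [K], with the default [1%g] keeping all values in [C], where
   translations preserve the density used below. *)
pose g i := xget (1%g : G) [set k | K k /\ code k = i].
have Cg i : C (g i).
  by rewrite /g; case: xgetP => [k _ [Kk _]|_]; [exact: KC|exact: subgroup1].
have Kg k : K k -> g (code k) = k.
  move=> Kk; have [|Kg gk] := @xgetPex _ (1%g : G) [set l | K l /\ code l = code k].
    by exists k.
  by apply: code_inj gk; rewrite inE.
(* For fixed [i], the intersection over [N] of the [U (i, N)] consists of points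
   scrambled against [g i]. *)
pose U (p : nat * nat) : set G :=
  (\bigcup_(n in [set n | (p.2 <= n)%N])
    iter n T @^-1` [set y | d (iter n T (g p.1)) y < p.2.+1%:R^-1]) `&`
  (\bigcup_(n in [set n | (p.2 <= n)%N])
    iter n T @^-1` [set y | c / 2 < d (iter n T (g p.1)) y]).
have [|||y Cy Uy] := Baire_closed rho_compat rho_complete (U := U)
    (@closed_closure _ (null_along phi)).
- by exists 1%g; exact: subgroup1 sC.
- move=> p; apply: openI; apply: bigcup_open => n _.
    by apply: open_comp => [? _|]; [exact: continuous_iter|exact: open_dist_lt].
  by apply: open_comp => [? _|]; [exact: continuous_iter|exact: open_dist_gt].
- move=> [i N] a W Ca Wo Wa.
  have [z [Hz Wz zc]] : exists z, [/\ null_along phi z,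
      W (g i * z)%g & scrambled d T (c / 2) 1%g z].
    apply: (@dense_scrambled ((g i)^-1 * a)%g ((fun z => g i * z)%g @^-1` W)).
    + exact: (subgroupM sC) (subgroupV sC (Cg i)) Ca.
    + by apply: open_comp => // ? _; exact: mulg_left_continuous.
    + by rewrite /= mulVKg.
  exists (g i * z)%g; split=> //.
    exact: (subgroupM sC) (Cg i) (subset_closure Hz).
  have [prox sep] : scrambled d T (c / 2) (g i) (g i * z)%g.
    by rewrite -{1}[g i]mulg1; apply/scrambled_translate.
  split.
    have [|n Nn dn] := prox N.+1%:R^-1 _ N; first by rewrite invr_gt0.
    by exists n.
  by have [n Nn dn] := sep N; exists n.
have Ky k : K k -> scrambled d T (c / 2) k y.
  move=> /Kg <-; split=> [e e0 N|N]; last first.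
    by have [_ [n Nn dn]] := Uy (code k, N); exists n.
  have [M _ Me] := near_infty_natSinv_lt (PosNum e0).
  have [[n /= Mn dn] _] := Uy (code k, maxn M N).
  exists n; first exact: leq_trans (leq_maxr _ _) Mn.
  by apply: lt_trans dn _; apply: Me => /=; exact: leq_maxl.
have c2_gt0 : 0 < c / 2 by rewrite divr_gt0.
apply: (Kmax (K `|` [set y])).
  split; first exact: subsetUl.
  move=> /(_ y (or_intror erefl)) /Ky.
  exact: not_scrambled_refl.
split; first by move=> z [/KC|->].
move=> u v [Ku|->] [Kv|->] uv.
- exact: Kscr.
- exact: Ky.
- by apply: scrambled_sym => //; exact: Ky.
- by [].
Qed.

End Recurrence.
End Endomorphism.

Theorem theorem3p15 (R : realType) (G : topologicalGroupType)
    (Gcm : completely_metrizable R G)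
    (d : G -> G -> R) (d_compat : compatible_metric d) (d_left : left_invariant d)
    (T : UMagmaMorphism.type G G) (T_cont : continuous T) :
  [<-> exists x : G, semi_irregular d T 1%g x;
       exists x y : G, LiYorke_pair d T x y;
       LiYorke_chaotic d T;
       LiYorke_sensitive d T;
       has_dense_semi_irregular_restriction d T].
Proof.
have scrambled_of_pair x y : LiYorke_pair d T x y ->
    exists c z phi, [/\ 0 < c, scrambled d T c 1%g z,
      (forall k, (k <= phi k)%N) & null_along T phi z].
  move=> /(LiYorke_pairP T d_compat)[c c0 xy].
  have zc : scrambled d T c 1%g (x^-1 * y)%g.
    by apply/(scrambled_translate d_left T c x); rewrite mulg1 mulVKg.
  have [phi phi_ge z_null] := exists_null_along d_compat zc.
  by exists c, (x^-1 * y)%g, phi.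
tfae.
- move=> [x /(semi_irregularP d_compat)[c c0 xc]]; exists 1%g, x.
  by apply/LiYorke_pairP => //; exists c.
- move=> [x [y /scrambled_of_pair[c [z [phi [c0 [_ z_far] phi_ge z_null]]]]]].
  exact: scrambled_chaotic z_far Gcm.
- move=> [K [Kunc Kpair]].
  have [x [y [Kx Ky xy]]] : exists x y, [/\ K x, K y & x <> y].
    apply: contrapT => K1; apply: Kunc.
    apply/countable_injP; exists (fun=> 0%N) => x y.
    rewrite !inE => Kx Ky _; apply: contrapT => xy.
    by apply: K1; exists x, y.
  have [c [z [phi [c0 [_ z_far] phi_ge z_null]]]] :=
    scrambled_of_pair _ _ (Kpair x y Kx Ky xy).
  exact: scrambled_sensitive z_far.
- move=> [c c0 /(_ 1%g 1 ltr01)[y [_ /(delta_pair_LiYorke_pair c0)]]].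
  move=> /scrambled_of_pair[c' [z [phi [c'0 [_ z_far] phi_ge z_null]]]].
  exact: scrambled_dense_restriction z_far.
- move=> [H [sH [TH [_ Hdense]]]].
  have [|x [_]] := Hdense setT _ openT; first by exists (subgroup_one sH).
  by rewrite /= semi_irregular_restriction; exists (\val x).
Qed.
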